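(* Let $f$ be of bistable type and let $g$ be an admissible damping coefficient (both defined in the context). For each $\tau\in[0,\tau_m]$ let $U=U(\xi)$ be the monotone front solution with speed $c=c_*(\tau)$ described in the context, and put $U_+=1$, $U_-=0$. Then there exist constants $C>0$ and $\eta>0$ (uniform in $\xi$) such that for $j=0,1,2$ $$|\partial_\xi^j(U(\xi)-U_+)|\le Ce^{-\eta|\xi|}\ \text{ for all }\xi\ge0,\qquad |\partial_\xi^j(U(\xi)-U_-)|\le Ce^{-\eta|\xi|}\ \text{ for all }\xi\le0.$$
   Context: Bistable type: $f:\mathbb{R}\to\mathbb{R}$, $f\in C^2([0,1];\mathbb{R})$, and for some $\alpha\in(0,1)$: $f(0)=f(\alpha)=f(1)=0$, $f'(0)<0$, $f'(1)<0$, $f'(\alpha)>0$, $f>0$ on $(\alpha,1)$, $f<0$ on $(0,\alpha)$. Admissible damping coefficient: for a fixed $\tau_m>0$, $g=g(u,\tau)\in C^1(\mathbb{R}\times[0,\tau_m];\mathbb{R})$ and $\inf\{g(u,\tau):u\in\mathbb{R},\ \tau\in(0,\tau_m)\}\ge\delta_0$ for some $\delta_0>0$. Front: for each $\tau\in[0,\tau_m]$ there is a unique $c=c_*(\tau)\in\mathbb{R}$ for which $(1-c^2\tau)U''+c\,g(U,\tau)U'+f(U)=0$ on $\mathbb{R}$ has a monotone increasing solution $U$ with $U(-\infty)=0$, $U(+\infty)=1$; it satisfies $c^2\tau<1$. *)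

(* Defs.v *)
From Stdlib Require Export Reals.
From Coquelicot Require Export Coquelicot.
Open Scope R_scope.

(* [f] is only assumed regular on [0,1]: its derivatives there are relative to
   [0,1] (hence one-sided at 0 and 1), and nothing is required of [f] outside. *)
Definition C2_unit (f f1 f2 : R -> R) : Prop :=
  let I := fun x => 0 <= x <= 1 in
  (forall x, I x -> D_in f f1 I x) /\
  (forall x, I x -> D_in f1 f2 I x) /\
  continuous_on I f2.

Definition bistable (f : R -> R) : Prop :=
  exists f1 f2 : R -> R, C2_unit f f1 f2 /\
  exists alpha : R, 0 < alpha < 1 /\
    f 0 = 0 /\ f alpha = 0 /\ f 1 = 0 /\
    f1 0 < 0 /\ f1 1 < 0 /\ 0 < f1 alpha /\
    (forall u, alpha < u < 1 -> 0 < f u) /\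
    (forall u, 0 < u < alpha -> f u < 0).

(* [g] is C^1 on the closed strip R x [0,taum]: the tau-derivative is one-sided
   at tau = 0 and tau = taum, and both partial derivatives are jointly
   continuous relative to the strip. *)
Definition C1_strip (taum : R) (g : R -> R -> R) : Prop :=
  let J := fun tau => 0 <= tau <= taum in
  let S := fun p : R * R => J (snd p) in
  exists gu gt : R -> R -> R,
    (forall u tau, J tau -> is_derive (fun v => g v tau) u (gu u tau)) /\
    (forall u tau, J tau -> D_in (fun s => g u s) (fun s => gt u s) J tau) /\
    continuous_on S (fun p => gu (fst p) (snd p)) /\
    continuous_on S (fun p => gt (fst p) (snd p)).

Definition admissible_damping (taum : R) (g : R -> R -> R) : Prop :=
  C1_strip taum g /\
  exists delta0 : R, 0 < delta0 /\
    Rbar_le delta0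
      (Glb_Rbar (fun y => exists u tau, 0 < tau < taum /\ y = g u tau)).

(* Each [tau] admits exactly one speed [c] carrying such a profile; that [c] is
   c_*(tau).  Neither c^2 tau < 1 nor strict monotonicity is assumed: both
   follow. *)
Definition monotone_front (f : R -> R) (g : R -> R -> R) (tau c : R)
    (U : R -> R) : Prop :=
  (forall xi, ex_derive U xi) /\
  (forall xi, ex_derive (Derive U) xi) /\
  (forall xi, (1 - c ^ 2 * tau) * Derive_n U 2 xi
              + c * g (U xi) tau * Derive U xi + f (U xi) = 0) /\
  (forall x y, x <= y -> U x <= U y) /\
  is_lim U m_infty 0 /\
  is_lim U p_infty 1.

Definition U_plus : R := 1.
Definition U_minus : R := 0.

(* Main.v *)
Require Import Defs.
From Stdlib Require Import Lra Lia.

(** Put [D = 1 - c^2 tau].  Each end of the front, after the reflection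
    [x -> - x] at the left one, is a nonnegative nonincreasing function [w]
    tending to 0 at [+oo] with [D w'' + b w' = phi], where [b] is bounded and,
    because [f' < 0] at the rest states, [k w <= phi <= K w] far out, for some
    [k > 0].

    If [D > 0], comparing [- w'] with multiples of [w] gives everything.  For
    small [eta], the function [eta w + w'] satisfies [q' >= M q] with [M >= 0];
    were it positive somewhere it would stay bounded away from 0, although
    [w -> 0] and [w' <= 0].  Hence [w' <= - eta w], and [w] decays
    exponentially ([tail_slope_lower]).  For large [L], the function
    [- w' - L w] satisfies an inequality of the same kind; were it positive
    somewhere, [w] would fall below 0.  Hence [- w' <= L w]
    ([tail_slope_upper]), and the equation bounds [w''] by a multiple of [w].
    Continuity covers the remaining compact interval.

    That [D > 0] is [front_coef_pos].  Since [g >= 0], there is an end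
    (the right one if [c > 0], the left one if [c < 0]) at which [b] and [phi]
    are both nonnegative, so [D w''] is too.  If [D = 0] the equation fails at
    a point where [phi > 0]; if [D < 0] then [w'] is nonincreasing and somewhere
    negative, which drives [w] below 0 ([tail_coef_pos]). *)

(** * Elementary real analysis *)

Lemma derive_nonneg_nondecreasing (h h1 : R -> R) (a : R) :
  (forall x, a <= x -> is_derive h x (h1 x)) ->
  (forall x, a <= x -> 0 <= h1 x) ->
  forall x y, a <= x -> x <= y -> h x <= h y.
Proof.
intros Hd Hp x y Hax Hxy.
destruct (MVT_gen h x y h1) as [z [[Hz1 Hz2] Hz]].
- intros z Hz. rewrite Rmin_left in Hz by lra. apply Hd; lra.
- intros z Hz. rewrite Rmin_left in Hz by lra.
  apply continuity_pt_filterlim, (ex_derive_continuous h).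
  exists (h1 z). apply Hd; lra.
- rewrite Rmin_left in Hz1 by lra.
  assert (0 <= h1 z * (y - x)).
  { apply Rmult_le_pos; [apply Hp; lra | lra]. }
  lra.
Qed.

Lemma exp_nondecreasing (x y : R) : x <= y -> exp x <= exp y.
Proof.
intros [H | H]; [left; now apply exp_increasing | right; now rewrite H].
Qed.

(** Gronwall's inequality, from below; the rate [M] may have either sign. *)
Lemma gronwall_lower (r r1 : R -> R) (M a : R) :
  (forall x, a <= x -> is_derive r x (r1 x)) ->
  (forall x, a <= x -> M * r x <= r1 x) ->
  forall x, a <= x -> r a * exp (M * (x - a)) <= r x.
Proof.
intros Hd Hr x Hx.
assert (H : r a * exp (- M * (a - a)) <= r x * exp (- M * (x - a))).
{ apply (derive_nonneg_nondecreasing (fun y => r y * exp (- M * (y - a)))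
    (fun y => (r1 y - M * r y) * exp (- M * (y - a))) a); try lra.
  - intros y Hy. specialize (Hd y Hy).
    assert (He : is_derive (fun y => exp (- M * (y - a))) y
                   (- M * exp (- M * (y - a)))).
    { auto_derive; [easy | unfold Rminus; ring]. }
    evar_last.
    + apply (is_derive_mult r _ y _ _ Hd He). intros; apply Rmult_comm.
    + unfold plus, mult; simpl; ring.
  - intros y Hy. specialize (Hr y Hy).
    apply Rmult_le_pos; [lra | left; apply exp_pos]. }
replace (- M * (a - a)) with 0 in H by ring. rewrite exp_0, Rmult_1_r in H.
apply (Rmult_le_compat_r (exp (M * (x - a)))) in H; [| left; apply exp_pos].
rewrite Rmult_assoc, <- exp_plus in H.
replace (- M * (x - a) + M * (x - a)) with 0 in H by ring.
rewrite exp_0, Rmult_1_r in H. exact H.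
Qed.

Lemma gronwall_stays_above (r r1 : R -> R) (M a : R) :
  0 <= M -> 0 < r a ->
  (forall x, a <= x -> is_derive r x (r1 x)) ->
  (forall x, a <= x -> M * r x <= r1 x) ->
  forall x, a <= x -> r a <= r x.
Proof.
intros HM Ha Hd Hr x Hx.
apply Rle_trans with (2 := gronwall_lower r r1 M a Hd Hr x Hx).
rewrite <- (Rmult_1_r (r a)) at 1. apply Rmult_le_compat_l; [lra |].
rewrite <- exp_0. apply exp_nondecreasing. apply Rmult_le_pos; lra.
Qed.

Lemma derive_bounded_below_unbounded (h h1 : R -> R) (a e m : R) :
  0 < e ->
  (forall x, a <= x -> is_derive h x (h1 x)) ->
  (forall x, a <= x -> e <= h1 x) ->
  ~ (forall x, a <= x -> h x <= m).
Proof.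
intros He Hd H1 Hm.
set (y := a + (Rabs (m - h a) + 1) / e).
assert (Hy : a <= y).
{ unfold y. assert (0 < (Rabs (m - h a) + 1) / e).
  { apply Rdiv_lt_0_compat; [| easy]. generalize (Rabs_pos (m - h a)); lra. }
  lra. }
assert (H : h a - e * a <= h y - e * y).
{ apply (derive_nonneg_nondecreasing (fun x => h x - e * x)
           (fun x => h1 x - e) a); try lra.
  - intros x Hx. evar_last.
    + apply (is_derive_minus h (fun x => e * x) x _ e (Hd x Hx)).
      auto_derive; [easy | ring].
    + reflexivity.
  - intros x Hx. specialize (H1 x Hx). lra. }
specialize (Hm y Hy).
assert (e * y = e * a + (Rabs (m - h a) + 1)) by (unfold y; field; lra).
generalize (Rle_abs (m - h a)). lra.
Qed.

Lemma continuous_bounded_segment (h : R -> R) (a b : R) :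
  a <= b -> (forall x, a <= x <= b -> continuity_pt h x) ->
  exists M, forall x, a <= x <= b -> Rabs (h x) <= M.
Proof.
intros Hab Hc.
destruct (continuity_ab_maj (fun x => Rabs (h x)) a b Hab) as [z [Hz _]].
- intros x Hx. apply (continuity_pt_comp h Rabs); [now apply Hc |].
  apply Rcontinuity_abs.
- now exists (Rabs (h z)).
Qed.

Lemma continue_in_comp (f h : R -> R) (I : R -> Prop) (x : R) :
  (forall y, I (h y)) -> continue_in f I (h x) -> continuity_pt h x ->
  continuity_pt (fun y => f (h y)) x.
Proof.
intros HI Hf Hh e He.
destruct (Hf e He) as [d [Hd Hfd]].
destruct (Hh d Hd) as [d' [Hd' Hhd]].
exists d'. split; [easy |]. intros y Hy.
destruct (Req_dec (h y) (h x)) as [E | E].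
- simpl. unfold Rdist. rewrite E, Rminus_diag, Rabs_R0. exact He.
- apply Hfd. split; [split; [apply HI | auto] |]. now apply Hhd.
Qed.

(** * Exponential decay on the half-line *)

(** [h] decays exponentially on the half-line [x >= 0]. *)
Definition exp_decay (h : R -> R) : Prop :=
  exists C eta, 0 < C /\ 0 < eta /\
    forall x, 0 <= x -> Rabs (h x) <= C * exp (- eta * x).

Lemma exp_decay_of_tail (h : R -> R) (X C eta : R) :
  (forall x, continuity_pt h x) -> 0 < eta ->
  (forall x, X <= x -> Rabs (h x) <= C * exp (- eta * (x - X))) ->
  exp_decay h.
Proof.
intros Hc Heta HX.
destruct (continuous_bounded_segment h 0 (Rmax 0 X) (Rmax_l 0 X)) as [M HM].
{ now intros x _. }
generalize (Rmax_l 0 X) (Rmax_r 0 X); intros HY0 HYX.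
set (Y := Rmax 0 X) in *.
assert (HM0 : 0 <= M).
{ apply Rle_trans with (2 := HM 0 (conj (Rle_refl _) HY0)). apply Rabs_pos. }
assert (HC0 : 0 <= C).
{ assert (H := HX X (Rle_refl X)). rewrite Rminus_diag, Rmult_0_r, exp_0 in H.
  generalize (Rabs_pos (h X)). lra. }
exists ((M + C + 1) * exp (eta * Y)), eta.
split; [apply Rmult_lt_0_compat; [lra | apply exp_pos] |].
split; [easy |]. intros x Hx.
rewrite Rmult_assoc, <- exp_plus.
destruct (Rle_lt_dec x Y) as [HxY | HxY].
- apply Rle_trans with (1 := HM x (conj Hx HxY)).
  rewrite <- (Rmult_1_r M) at 1.
  apply Rmult_le_compat; try lra.
  rewrite <- exp_0. apply exp_nondecreasing.
  replace (eta * Y + - eta * x) with (eta * (Y - x)) by ring.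
  apply Rmult_le_pos; lra.
- apply Rle_trans with (1 := HX x ltac:(lra)).
  apply Rmult_le_compat; try lra; [left; apply exp_pos |].
  apply exp_nondecreasing.
  assert (0 <= eta * (Y - X)) by (apply Rmult_le_pos; lra). lra.
Qed.

(** Two decaying functions share their constants, and these may be weakened
    afterwards. *)
Lemma exp_decay_uniform (h h' : R -> R) :
  exp_decay h -> exp_decay h' ->
  exists C eta, 0 < C /\ 0 < eta /\
    forall C' eta', C <= C' -> 0 < eta' <= eta -> forall x, 0 <= x ->
      Rabs (h x) <= C' * exp (- eta' * x) /\
      Rabs (h' x) <= C' * exp (- eta' * x).
Proof.
intros [C1 [e1 [HC1 [He1 H1]]]] [C2 [e2 [HC2 [He2 H2]]]].
exists (C1 + C2), (Rmin e1 e2).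
split; [lra |]. split; [now apply Rmin_glb_lt |].
intros C' e' HC' [He' He'm] x Hx.
generalize (Rmin_l e1 e2) (Rmin_r e1 e2); intros Hm1 Hm2.
assert (H : forall e, e' <= e -> exp (- e * x) <= exp (- e' * x)).
{ intros e Hee. apply exp_nondecreasing.
  assert (0 <= (e - e') * x) by (apply Rmult_le_pos; lra). lra. }
split; [apply Rle_trans with (1 := H1 x Hx) | apply Rle_trans with (1 := H2 x Hx)];
  apply Rmult_le_compat; try lra; try (left; apply exp_pos); apply H; lra.
Qed.

(** * Tails of a front *)

(** A tail is a nonnegative nonincreasing function [w] tending to 0 at
    [+oo], with derivatives [w1] and [w2], and solving
    [D w'' + b w' = phi].  Both ends of a front have this form: the
    right one with [w x = 1 - U x], [b = c g(U)], [phi = f(U)], the left one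
    with [w x = U (- x)] and the signs of [b] and [phi] reversed. *)
Definition tail (D : R) (w w1 w2 b phi : R -> R) : Prop :=
  (forall x, is_derive w x (w1 x)) /\
  (forall x, is_derive w1 x (w2 x)) /\
  (forall x, D * w2 x + b x * w1 x = phi x) /\
  (forall x, 0 <= w x) /\
  (forall x, w1 x <= 0) /\
  is_lim w p_infty 0.

Lemma lim_0_eventually_lt (w : R -> R) (e : R) :
  is_lim w p_infty 0 -> 0 < e -> exists X, forall x, X <= x -> w x < e.
Proof.
intros Hl He. apply is_lim_spec in Hl.
destruct (Hl (mkposreal e He)) as [X HX]. simpl in HX.
exists (X + 1). intros x Hx. specialize (HX x ltac:(lra)).
rewrite Rminus_0_r in HX. generalize (Rle_abs (w x)). lra.
Qed.

(** The signs of [b] and [phi] force [D w2 >= 0], which a bounded profile that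
    still has to descend from [w X > 0] only permits when [D > 0]. *)
Lemma tail_coef_pos (D X : R) (w w1 w2 b phi : R -> R) :
  tail D w w1 w2 b phi ->
  (forall x, X <= x -> 0 <= b x) ->
  (forall x, X <= x -> 0 <= phi x) ->
  0 < phi X -> 0 < w X -> 0 < D.
Proof.
intros (Hw & Hw1 & Heq & Hpos & Hneg & Hlim) Hb Hphi HphiX HwX.
destruct (Rlt_le_dec 0 D) as [HD | HD]; [easy | exfalso].
assert (Hbw : forall x, X <= x -> b x * w1 x <= 0).
{ intros x Hx. specialize (Hb x Hx). specialize (Hneg x).
  assert (0 <= b x * - w1 x) by (apply Rmult_le_pos; lra). lra. }
destruct (Req_dec D 0) as [HD0 | HD0].
{ specialize (Heq X). specialize (Hbw X (Rle_refl X)).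
  rewrite HD0, Rmult_0_l in Heq. lra. }
assert (Hw2 : forall x, X <= x -> 0 <= - w2 x).
{ intros x Hx. specialize (Heq x). specialize (Hbw x Hx).
  specialize (Hphi x Hx).
  apply Rmult_le_reg_l with (- D); [lra |]. lra. }
destruct (lim_0_eventually_lt w (w X) Hlim HwX) as [Y HY].
(* The profile has to descend after [X], so it has a negative slope there. *)
assert (Hz : exists z, X <= z /\ w1 z < 0).
{ set (y := Rmax X Y).
  assert (HXy : X <= y) by apply Rmax_l.
  destruct (MVT_gen w X y w1) as [z [[Hz1 Hz2] Hz]].
  - now intros.
  - intros z _. apply continuity_pt_filterlim, (ex_derive_continuous w).
    now exists (w1 z).
  - rewrite Rmin_left in Hz1 by easy.
    exists z. split; [easy |].
    specialize (HY y (Rmax_r _ _)).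
    destruct (Rlt_le_dec (w1 z) 0) as [? | Hz0]; [easy |].
    assert (0 <= w1 z * (y - X)) by (apply Rmult_le_pos; lra). lra. }
destruct Hz as [z [HXz Hz]].
apply (derive_bounded_below_unbounded (fun x => - w x) (fun x => - w1 x) z
         (- w1 z) 0); try lra.
- intros x _. apply (is_derive_opp w), Hw.
- intros x Hx.
  apply (derive_nonneg_nondecreasing (fun x => - w1 x) (fun x => - w2 x) X);
    try easy.
  intros t _. apply (is_derive_opp w1), Hw1.
- intros x _. specialize (Hpos x). lra.
Qed.

(** If [- w' < eta w] at some point, then [eta w + w'] never drops below its
    positive value there, which keeps [w] away from 0. *)
Lemma tail_slope_lower (D B k eta X : R) (w w1 w2 b phi : R -> R) :
  tail D w w1 w2 b phi -> 0 < D -> 0 < eta ->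
  (B + D * eta) * eta <= k ->
  (forall x, Rabs (b x) <= B) ->
  (forall x, X <= x -> k * w x <= phi x) ->
  forall x, X <= x -> eta * w x <= - w1 x.
Proof.
intros (Hw & Hw1 & Heq & Hpos & Hneg & Hlim) HD Heta Hk HB Hphi a Ha.
destruct (Rle_lt_dec (eta * w a) (- w1 a)) as [H | H]; [easy | exfalso].
assert (HB0 : 0 <= B).
{ apply Rle_trans with (2 := HB 0). apply Rabs_pos. }
destruct (lim_0_eventually_lt w ((eta * w a + w1 a) / eta) Hlim) as [Y HY].
{ apply Rdiv_lt_0_compat; lra. }
assert (Hq : eta * w a + w1 a
             <= eta * w (Rmax a Y) + w1 (Rmax a Y)).
{ apply (gronwall_stays_above (fun x => eta * w x + w1 x)
           (fun x => eta * w1 x + w2 x) ((B + D * eta) / D) a); try lra.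
  - apply Rmult_le_pos; [| left; now apply Rinv_0_lt_compat].
    assert (0 < D * eta) by now apply Rmult_lt_0_compat. lra.
  - intros x _. apply (is_derive_plus (fun x => eta * w x) w1); [| easy].
    apply (is_derive_scal w), Hw.
  - intros x Hx. apply Rmult_le_reg_l with D; [easy |].
    replace (D * ((B + D * eta) / D * (eta * w x + w1 x)))
      with ((B + D * eta) * eta * w x + (B + D * eta) * w1 x) by (field; lra).
    specialize (Heq x). specialize (Hpos x). specialize (Hneg x).
    specialize (Hphi x ltac:(lra)).
    assert (H1 : - B <= b x).
    { specialize (HB x). apply Rabs_le_between in HB. lra. }
    assert (H2 : (B + D * eta) * eta * w x <= k * w x)
      by now apply Rmult_le_compat_r.
    assert (H3 : 0 <= (B + b x) * - w1 x) by (apply Rmult_le_pos; lra).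
    replace (D * (eta * w1 x + w2 x))
      with (D * eta * w1 x + phi x - b x * w1 x) by (rewrite <- Heq; ring).
    lra.
  - apply Rmax_l. }
specialize (HY _ (Rmax_r a Y)). specialize (Hneg (Rmax a Y)).
apply (Rmult_lt_compat_l eta) in HY; [| easy].
replace (eta * ((eta * w a + w1 a) / eta)) with (eta * w a + w1 a) in HY
  by (field; lra).
lra.
Qed.

(** If [- w' > L w] at some point, then [- w' - L w] never drops below its
    positive value there, and [w] would become negative. *)
Lemma tail_slope_upper (D B K L X : R) (w w1 w2 b phi : R -> R) :
  tail D w w1 w2 b phi -> 0 < D -> 0 <= L ->
  B <= D * L -> K <= (D * L - B) * L ->
  (forall x, Rabs (b x) <= B) ->
  (forall x, X <= x -> phi x <= K * w x) ->
  forall x, X <= x -> - w1 x <= L * w x.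
Proof.
intros (Hw & Hw1 & Heq & Hpos & Hneg & Hlim) HD HL HBL HK HB Hphi a Ha.
destruct (Rle_lt_dec (- w1 a) (L * w a)) as [H | H]; [easy | exfalso].
apply (derive_bounded_below_unbounded (fun x => - w x) (fun x => - w1 x) a
         (- w1 a - L * w a) 0); try lra.
- intros x _. apply (is_derive_opp w), Hw.
- intros x Hx.
  apply Rle_trans with (- w1 x - L * w x).
  2: { assert (0 <= L * w x) by now apply Rmult_le_pos. lra. }
  apply (gronwall_stays_above (fun x => - w1 x - L * w x)
           (fun x => - w2 x - L * w1 x) ((D * L - B) / D) a); try lra.
  + apply Rmult_le_pos; [lra | left; now apply Rinv_0_lt_compat].
  + intros y _. apply (is_derive_minus (fun x => - w1 x) (fun x => L * w x)).
    * apply (is_derive_opp w1), Hw1.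
    * apply (is_derive_scal w), Hw.
  + intros y Hy. apply Rmult_le_reg_l with D; [easy |].
    replace (D * ((D * L - B) / D * (- w1 y - L * w y)))
      with (- (D * L - B) * w1 y - (D * L - B) * L * w y) by (field; lra).
    specialize (Heq y). specialize (Hpos y). specialize (Hneg y).
    specialize (Hphi y ltac:(lra)).
    assert (H1 := Rle_trans _ _ _ (Rle_abs (b y)) (HB y)).
    assert (H2 : K * w y <= (D * L - B) * L * w y)
      by now apply Rmult_le_compat_r.
    assert (H3 : 0 <= (B - b y) * - w1 y) by (apply Rmult_le_pos; lra).
    replace (D * (- w2 y - L * w1 y))
      with (- D * L * w1 y - phi y + b y * w1 y) by (rewrite <- Heq; ring).
    lra.
- intros x _. specialize (Hpos x). lra.
Qed.

Lemma tail_exp_decay (D B k K X : R) (w w1 w2 b phi : R -> R) :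
  tail D w w1 w2 b phi -> 0 < D -> 0 < k ->
  (forall x, Rabs (b x) <= B) ->
  (forall x, X <= x -> k * w x <= phi x <= K * w x) ->
  (forall x, continuity_pt w2 x) ->
  exp_decay w /\ exp_decay w1 /\ exp_decay w2.
Proof.
intros Ht HD Hk HB Hphi Hc2.
assert (Ht' := Ht). destruct Ht' as (Hw & Hw1 & Heq & Hpos & Hneg & Hlim).
assert (HB0 : 0 <= B).
{ apply Rle_trans with (2 := HB 0). apply Rabs_pos. }
(* [eta <= 1] and [eta <= k / (B + D)] make [(B + D eta) eta <= k]. *)
set (eta := Rmin 1 (k / (B + D))).
assert (Heta : 0 < eta).
{ apply Rmin_glb_lt; [lra | apply Rdiv_lt_0_compat; lra]. }
assert (Hetak : (B + D * eta) * eta <= k).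
{ assert (H1 : eta <= 1) by apply Rmin_l.
  assert (H2 : (B + D) * eta <= k).
  { apply Rle_trans with ((B + D) * (k / (B + D))).
    - apply Rmult_le_compat_l; [lra | apply Rmin_r].
    - right; field; lra. }
  apply Rle_trans with (2 := H2). apply Rmult_le_compat_r; [lra |].
  assert (D * eta <= D * 1) by (apply Rmult_le_compat_l; lra). lra. }
(* With this [L], both [D L - B >= 1] and [L >= |K|]. *)
set (L := (B + 1) / D + Rabs K).
assert (HB1D : 0 < (B + 1) / D) by (apply Rdiv_lt_0_compat; lra).
assert (HL0 : 0 <= L) by (unfold L; generalize (Rabs_pos K); lra).
assert (HDL : 1 <= D * L - B).
{ unfold L. replace (D * ((B + 1) / D + Rabs K) - B)
    with (1 + D * Rabs K) by (field; lra).
  assert (0 <= D * Rabs K) by (apply Rmult_le_pos; [lra | apply Rabs_pos]).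
  lra. }
assert (HKL : K <= (D * L - B) * L).
{ apply Rle_trans with (1 * L).
  - unfold L. generalize (Rle_abs K). lra.
  - now apply Rmult_le_compat_r. }
assert (Hlow := tail_slope_lower D B k eta X w w1 w2 b phi Ht HD Heta Hetak HB
                  (fun x Hx => proj1 (Hphi x Hx))).
assert (Hup := tail_slope_upper D B K L X w w1 w2 b phi Ht HD HL0 ltac:(lra)
                 HKL HB (fun x Hx => proj2 (Hphi x Hx))).
assert (Hdec : forall x, X <= x -> w x <= w X * exp (- eta * (x - X))).
{ intros x Hx.
  assert (H : - w X * exp (- eta * (x - X)) <= - w x).
  { apply (gronwall_lower (fun x => - w x) (fun x => - w1 x) (- eta) X);
      [| | easy].
    - intros y _. apply (is_derive_opp w), Hw.
    - intros y Hy. specialize (Hlow y Hy). lra. }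
  lra. }
assert (Hdec' : forall h A, (forall x, continuity_pt h x) -> 0 <= A ->
  (forall x, X <= x -> Rabs (h x) <= A * w x) -> exp_decay h).
{ intros h A Hc HA H. apply (exp_decay_of_tail h X (A * w X) eta Hc Heta).
  intros x Hx. apply Rle_trans with (1 := H x Hx).
  rewrite Rmult_assoc. apply Rmult_le_compat_l; [easy | now apply Hdec]. }
assert (Hcont : forall h h1, (forall x, is_derive h x (h1 x)) ->
                  forall x, continuity_pt h x).
{ intros h h1 H x. apply continuity_pt_filterlim, (ex_derive_continuous h).
  now exists (h1 x). }
split; [| split].
- apply (Hdec' w 1); [now apply (Hcont w w1) | lra |].
  intros x _. rewrite Rabs_pos_eq by easy. lra.
- apply (Hdec' w1 L); [now apply (Hcont w1 w2) | easy |].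
  intros x Hx. rewrite Rabs_left1 by easy. now apply Hup.
- assert (HA : 0 <= (B * L + Rabs K) / D).
  { apply Rmult_le_pos; [| left; now apply Rinv_0_lt_compat].
    assert (0 <= B * L) by now apply Rmult_le_pos.
    generalize (Rabs_pos K). lra. }
  apply (Hdec' w2 ((B * L + Rabs K) / D)); [easy | easy |].
  intros x Hx.
  replace (w2 x) with ((phi x + - (b x * w1 x)) / D)
    by (rewrite <- (Heq x); field; lra).
  unfold Rdiv. rewrite Rabs_mult, (Rabs_pos_eq (/ D))
    by (left; now apply Rinv_0_lt_compat).
  replace ((B * L + Rabs K) * / D * w x)
    with ((Rabs K * w x + B * (L * w x)) * / D) by ring.
  apply Rmult_le_compat_r; [left; now apply Rinv_0_lt_compat |].
  apply Rle_trans with (1 := Rabs_triang _ _).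
  rewrite Rabs_Ropp, Rabs_mult, (Rabs_left1 (w1 x)) by easy.
  destruct (Hphi x Hx) as [Hp1 Hp2]. specialize (Hpos x).
  apply Rplus_le_compat.
  + assert (0 <= k * w x) by (apply Rmult_le_pos; lra).
    rewrite Rabs_pos_eq by lra. apply Rle_trans with (1 := Hp2).
    apply Rmult_le_compat_r; [easy | apply Rle_abs].
  + apply Rmult_le_compat; [apply Rabs_pos | specialize (Hneg x); lra | easy |].
    now apply Hup.
Qed.

(** * Fronts *)

Lemma monotone_front_range (f : R -> R) (g : R -> R -> R) (tau c : R)
    (U : R -> R) : monotone_front f g tau c U -> forall x, 0 <= U x <= 1.
Proof.
intros (_ & _ & _ & Hmon & Hm & Hp) x. split.
- apply (is_lim_le_loc U (fun _ => U x) m_infty 0 (U x));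
    [| easy | apply is_lim_const].
  exists x. intros y Hy. apply Hmon. lra.
- apply (is_lim_le_loc (fun _ => U x) U p_infty (U x) 1);
    [| apply is_lim_const | easy].
  exists x. intros y Hy. apply Hmon. lra.
Qed.

Lemma monotone_front_attains (f : R -> R) (g : R -> R -> R) (tau c : R)
    (U : R -> R) (m : R) :
  monotone_front f g tau c U -> 0 < m < 1 -> exists x, U x = m.
Proof.
intros (Hd & _ & _ & Hmon & Hm & Hp) H.
apply is_lim_spec in Hm. apply is_lim_spec in Hp.
destruct (Hm (mkposreal m (proj1 H))) as [a Ha].
destruct (Hp (mkposreal (1 - m) ltac:(lra))) as [b Hb]. simpl in Ha, Hb.
specialize (Ha (a - 1) ltac:(lra)). specialize (Hb (b + 1) ltac:(lra)).
apply Rabs_lt_between in Ha. apply Rabs_lt_between in Hb.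
assert (Hab : a - 1 <= b + 1).
{ destruct (Rle_lt_dec (a - 1) (b + 1)) as [? | Hab]; [easy |].
  generalize (Hmon (b + 1) (a - 1) ltac:(lra)). lra. }
destruct (IVT_cor (fun x => U x - m) (a - 1) (b + 1)) as [z [_ Hz]]; try easy.
- intros x. apply continuity_pt_filterlim, (ex_derive_continuous (fun x => U x - m)).
  auto_derive. apply Hd.
- assert (0 <= (m - U (a - 1)) * (U (b + 1) - m)) by (apply Rmult_le_pos; lra).
  lra.
- exists z. lra.
Qed.

Lemma monotone_front_derive_nonneg (f : R -> R) (g : R -> R -> R) (tau c : R)
    (U : R -> R) : monotone_front f g tau c U -> forall x, 0 <= Derive U x.
Proof.
intros (Hd & _ & _ & Hmon & _) x.
destruct (Rle_lt_dec 0 (Derive U x)) as [? | Hneg]; [easy | exfalso].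
assert (HD := Derive_correct U x (Hd x)). apply is_derive_Reals in HD.
destruct (HD (- Derive U x) ltac:(lra)) as [d H].
assert (Hd2 : 0 < d / 2) by (generalize (cond_pos d); lra).
specialize (H (d / 2) ltac:(lra)).
rewrite (Rabs_pos_eq (d / 2)) in H by lra.
specialize (H ltac:(generalize (cond_pos d); lra)).
apply Rabs_lt_between in H.
assert (0 <= (U (x + d / 2) - U x) / (d / 2)).
{ apply Rmult_le_pos; [| left; now apply Rinv_0_lt_compat].
  generalize (Hmon x (x + d / 2) ltac:(lra)). lra. }
lra.
Qed.

(** The right end of a front. *)
Lemma front_tail_right (f : R -> R) (g : R -> R -> R) (tau c : R)
    (U : R -> R) : monotone_front f g tau c U ->
  tail (1 - c ^ 2 * tau) (fun x => 1 - U x) (fun x => - Derive U x)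
    (fun x => - Derive_n U 2 x) (fun x => c * g (U x) tau) (fun x => f (U x)).
Proof.
intros HU. assert (HU' := HU). destruct HU' as (Hd & Hd2 & Heq & _ & _ & Hp).
split; [| split; [| split; [| split; [| split]]]].
- intros x. auto_derive; [apply Hd | ring_simplify; easy].
- intros x. apply (is_derive_opp (Derive U)). now apply Derive_correct.
- intros x. specialize (Heq x). lra.
- intros x. generalize (monotone_front_range _ _ _ _ _ HU x). lra.
- intros x. generalize (monotone_front_derive_nonneg _ _ _ _ _ HU x). lra.
- evar_last.
  + apply (is_lim_minus' (fun _ => 1) U p_infty 1 1); [apply is_lim_const | easy].
  + f_equal. ring.
Qed.

(** The left end of a front, reflected. *)
Lemma front_tail_left (f : R -> R) (g : R -> R -> R) (tau c : R)
    (U : R -> R) : monotone_front f g tau c U ->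
  tail (1 - c ^ 2 * tau) (fun x => U (- x)) (fun x => - Derive U (- x))
    (fun x => Derive_n U 2 (- x)) (fun x => - c * g (U (- x)) tau)
    (fun x => - f (U (- x))).
Proof.
intros HU. assert (HU' := HU). destruct HU' as (Hd & Hd2 & Heq & _ & Hm & _).
assert (Hopp : forall x, is_derive (fun x => - x) x (- 1)).
{ intros x. auto_derive; easy. }
split; [| split; [| split; [| split; [| split]]]].
- intros x. evar_last.
  + apply (is_derive_comp U (fun x => - x)); [| apply Hopp].
    apply Derive_correct, Hd.
  + unfold scal; simpl; unfold mult; simpl; ring.
- intros x. evar_last.
  + apply (is_derive_opp (fun x => Derive U (- x))).
    apply (is_derive_comp (Derive U) (fun x => - x)); [| apply Hopp].
    apply Derive_correct, Hd2.
  + change (Derive_n U 2 (- x)) with (Derive (Derive U) (- x)).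
    unfold scal, opp; simpl; unfold mult; simpl; ring.
- intros x. specialize (Heq (- x)). lra.
- intros x. apply (monotone_front_range _ _ _ _ _ HU).
- intros x. generalize (monotone_front_derive_nonneg _ _ _ _ _ HU (- x)). lra.
- apply is_lim_spec in Hm. apply is_lim_spec. intros e.
  destruct (Hm e) as [M HM]. exists (- M). intros y Hy. apply HM. lra.
Qed.

(** The lower bound on the damping is only given for interior delays; it
    passes to the endpoint [taum] by continuity in the delay. *)
Lemma admissible_damping_nonneg (taum : R) (g : R -> R -> R) (u tau : R) :
  admissible_damping taum g -> 0 < tau <= taum -> 0 <= g u tau.
Proof.
intros [[gu [gt [_ [Ht _]]]] [d0 [Hd0 Hglb]]] Htau.
assert (Hint : forall s, 0 < s < taum -> 0 <= g u s).
{ intros s Hs. apply Rle_trans with d0; [lra |].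
  apply (Rbar_le_trans d0 _ (g u s) Hglb).
  apply Glb_Rbar_correct. now exists u, s. }
destruct (Rlt_le_dec tau taum) as [H | H]; [apply Hint; lra |].
destruct (Rle_lt_dec 0 (g u tau)) as [? | Hneg]; [easy | exfalso].
assert (Hc := cont_deriv _ _ _ _ (Ht u tau ltac:(lra))).
destruct (Hc (- g u tau) ltac:(lra)) as [a [Ha Hca]].
set (s := Rmax (tau / 2) (tau - a / 2)).
assert (Hs1 : tau / 2 <= s) by apply Rmax_l.
assert (Hs2 : tau - a / 2 <= s) by apply Rmax_r.
assert (Hs3 : s < tau) by (apply Rmax_lub_lt; lra).
assert (Hgs := Hint s ltac:(lra)).
specialize (Hca s). simpl in Hca. unfold Rdist in Hca.
assert (Habs : Rabs (g u s - g u tau) < - g u tau).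
{ apply Hca. split; [split; lra |]. rewrite Rabs_left1; lra. }
apply Rabs_lt_between in Habs. lra.
Qed.

(** Near a zero of [f] with negative derivative relative to [I], the difference
    quotient [q] lies between 3/2 and 1/2 of that derivative. *)
Lemma D_in_linear_bounds (f f1 : R -> R) (I : R -> Prop) (x0 : R) :
  D_in f f1 I x0 -> f x0 = 0 -> f1 x0 < 0 ->
  exists d, 0 < d /\ forall x, I x -> Rabs (x - x0) < d ->
    exists q, f x = q * (x - x0) /\ 3 / 2 * f1 x0 <= q <= f1 x0 / 2.
Proof.
intros HD H0 Hneg.
destruct (HD (- f1 x0 / 2) ltac:(lra)) as [d [Hd H]].
exists d. split; [easy |]. intros x HI Hx.
destruct (Req_dec x x0) as [E | E].
- exists (f1 x0 / 2). subst x. lra.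
- exists ((f x - f x0) / (x - x0)). split; [rewrite H0; field; lra |].
  assert (Hq : Rabs ((f x - f x0) / (x - x0) - f1 x0) < - f1 x0 / 2).
  { apply H. split; [split; auto | exact Hx]. }
  apply Rabs_lt_between in Hq. lra.
Qed.

Section Front.

Variables (taum : R) (f : R -> R) (g : R -> R -> R) (tau c : R) (U : R -> R).
Hypothesis hf : bistable f.
Hypothesis hg : admissible_damping taum g.
Hypothesis htau : 0 <= tau <= taum.
Hypothesis hU : monotone_front f g tau c U.

Lemma front_coef_pos : 0 < 1 - c ^ 2 * tau.
Proof.
destruct (Rlt_le_dec 0 (1 - c ^ 2 * tau)) as [? | HD]; [easy |].
destruct hf as [f1 [f2 [_ [al [Hal [H0 [Ha [H1 [_ [_ [_ [Hpos Hneg]]]]]]]]]]]].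
assert (Hmon : forall x y, x <= y -> U x <= U y) by apply hU.
assert (Hrange := monotone_front_range _ _ _ _ _ hU).
assert (Htau0 : 0 < tau).
{ destruct (Req_dec tau 0) as [E | E]; [rewrite E in HD; lra | lra]. }
assert (Hg : forall u, 0 <= g u tau).
{ intros u. apply (admissible_damping_nonneg taum g u tau hg). lra. }
assert (Hc0 : c <> 0) by (intros E; rewrite E in HD; lra).
(* For [c > 0] the right end has [b, phi >= 0], for [c < 0] the left one. *)
destruct (Rlt_le_dec 0 c) as [Hc | Hc].
- destruct (monotone_front_attains _ _ _ _ _ ((1 + al) / 2) hU) as [X HX];
    [lra |].
  apply (tail_coef_pos _ X _ _ _ _ _ (front_tail_right _ _ _ _ _ hU)).
  + intros x _. apply Rmult_le_pos; [lra | apply Hg].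
  + intros x Hx. specialize (Hmon X x Hx). specialize (Hrange x).
    destruct (Req_dec (U x) 1) as [E | E]; [rewrite E; lra |].
    left; apply Hpos; lra.
  + rewrite HX. apply Hpos; lra.
  + rewrite HX. lra.
- destruct (monotone_front_attains _ _ _ _ _ (al / 2) hU) as [X HX]; [lra |].
  apply (tail_coef_pos _ (- X) _ _ _ _ _ (front_tail_left _ _ _ _ _ hU)).
  + intros x _. apply Rmult_le_pos; [lra | apply Hg].
  + intros x Hx. specialize (Hmon (- x) X ltac:(lra)).
    specialize (Hrange (- x)).
    destruct (Req_dec (U (- x)) 0) as [E | E]; [rewrite E; lra |].
    specialize (Hneg (U (- x)) ltac:(lra)). lra.
  + rewrite Ropp_involutive, HX. specialize (Hneg (al / 2) ltac:(lra)). lra.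
  + rewrite Ropp_involutive, HX. lra.
Qed.

Lemma front_continuous (x : R) : continuity_pt U x.
Proof.
apply continuity_pt_filterlim, (ex_derive_continuous U). apply hU.
Qed.

Lemma damping_continuous (u : R) : continuity_pt (fun v => g v tau) u.
Proof.
destruct hg as [[gu [gt [Hu _]]] _].
apply continuity_pt_filterlim, (ex_derive_continuous (fun v => g v tau)).
exists (gu u tau). now apply Hu.
Qed.

Lemma front_second_derivative_continuous (x : R) :
  continuity_pt (Derive_n U 2) x.
Proof.
assert (HD := front_coef_pos).
apply (continuity_pt_ext (fun y =>
  / (1 - c ^ 2 * tau) * (- (c * (g (U y) tau * Derive U y)) - f (U y)))).
{ intros y. assert (Heq : (1 - c ^ 2 * tau) * Derive_n U 2 y
              + c * g (U y) tau * Derive U y + f (U y) = 0) by apply hU.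
  apply Rmult_eq_reg_l with (1 - c ^ 2 * tau); [| lra].
  rewrite <- Rmult_assoc, Rinv_r by lra. lra. }
apply (continuity_pt_scal (fun y => - (c * (g (U y) tau * Derive U y)) - f (U y))).
apply (continuity_pt_minus (fun y => - (c * (g (U y) tau * Derive U y)))
         (fun y => f (U y))).
- apply (continuity_pt_opp (fun y => c * (g (U y) tau * Derive U y))).
  apply (continuity_pt_scal (fun y => g (U y) tau * Derive U y)).
  apply (continuity_pt_mult (fun y => g (U y) tau) (Derive U)).
  + apply (continuity_pt_comp U (fun v => g v tau));
      [apply front_continuous | apply damping_continuous].
  + apply continuity_pt_filterlim, (ex_derive_continuous (Derive U)), hU.
- destruct hf as [f1 [f2 [[Hf1 _] _]]].
  assert (Hrange := monotone_front_range _ _ _ _ _ hU).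
  apply (continue_in_comp f U (fun x => 0 <= x <= 1));
    [easy | | apply front_continuous].
  apply cont_deriv with f1, Hf1, Hrange.
Qed.

Lemma front_friction_bounded :
  exists B, forall x, Rabs (c * g (U x) tau) <= B.
Proof.
destruct (continuous_bounded_segment (fun v => g v tau) 0 1) as [M HM]; [lra | |].
{ intros; apply damping_continuous. }
exists (Rabs c * M). intros x. rewrite Rabs_mult.
apply Rmult_le_compat_l; [apply Rabs_pos |].
apply HM, (monotone_front_range _ _ _ _ _ hU).
Qed.

Lemma front_decay_right :
  exp_decay (fun x => 1 - U x) /\ exp_decay (fun x => - Derive U x) /\
  exp_decay (fun x => - Derive_n U 2 x).
Proof.
assert (Ht := front_tail_right _ _ _ _ _ hU).
destruct front_friction_bounded as [B HB].
destruct hf as [f1 [f2 [[Hf1 _] [al [_ [_ [_ [H1 [_ [Hneg _]]]]]]]]]].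
destruct (D_in_linear_bounds f f1 _ 1 (Hf1 1 ltac:(lra)) H1 Hneg) as [d [Hd Hq]].
destruct (lim_0_eventually_lt (fun x => 1 - U x) d) as [X HX]; [apply Ht | easy |].
apply (tail_exp_decay _ B (- f1 1 / 2) (- (3 / 2) * f1 1) X _ _ _ _ _ Ht);
  try assumption.
- apply front_coef_pos.
- lra.
- intros x Hx. assert (Hr := monotone_front_range _ _ _ _ _ hU x).
  specialize (HX x Hx).
  destruct (Hq (U x) Hr) as [q [E Hqb]]; [rewrite Rabs_left1; lra |].
  rewrite E.
  assert (0 <= (f1 1 / 2 - q) * (1 - U x)) by (apply Rmult_le_pos; lra).
  assert (0 <= (q - 3 / 2 * f1 1) * (1 - U x)) by (apply Rmult_le_pos; lra).
  lra.
- intros x. apply (continuity_pt_opp (Derive_n U 2)).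
  apply front_second_derivative_continuous.
Qed.

Lemma front_decay_left :
  exp_decay (fun x => U (- x)) /\ exp_decay (fun x => - Derive U (- x)) /\
  exp_decay (fun x => Derive_n U 2 (- x)).
Proof.
assert (Ht := front_tail_left _ _ _ _ _ hU).
destruct front_friction_bounded as [B HB].
destruct hf as [f1 [f2 [[Hf1 _] [al [_ [H0 [_ [_ [Hneg _]]]]]]]]].
destruct (D_in_linear_bounds f f1 _ 0 (Hf1 0 ltac:(lra)) H0 Hneg) as [d [Hd Hq]].
destruct (lim_0_eventually_lt (fun x => U (- x)) d) as [X HX]; [apply Ht | easy |].
apply (tail_exp_decay _ B (- f1 0 / 2) (- (3 / 2) * f1 0) X _ _ _ _ _ Ht);
  try assumption.
- apply front_coef_pos.
- lra.
- intros x. rewrite <- Ropp_mult_distr_l, Rabs_Ropp. apply HB.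
- intros x Hx. assert (Hr := monotone_front_range _ _ _ _ _ hU (- x)).
  specialize (HX x Hx). simpl in HX.
  destruct (Hq (U (- x)) Hr) as [q [E Hqb]];
    [rewrite Rminus_0_r, Rabs_pos_eq; lra |].
  rewrite E.
  assert (0 <= (f1 0 / 2 - q) * U (- x)) by (apply Rmult_le_pos; lra).
  assert (0 <= (q - 3 / 2 * f1 0) * U (- x)) by (apply Rmult_le_pos; lra).
  lra.
- intros x. apply (continuity_pt_comp Ropp (Derive_n U 2)).
  + apply (continuity_pt_opp (fun y => y)), continuity_pt_id.
  + apply front_second_derivative_continuous.
Qed.

End Front.

Lemma Derive_n_minus_const (U : R -> R) (a : R) (j : nat) (x : R) :
  (forall y, ex_derive U y) ->
  Derive_n (fun y => U y - a) (S j) x = Derive_n U (S j) x.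
Proof.
intros Hd. revert x. induction j as [| j IH]; intros x.
- change (Derive (fun y => U y - a) x = Derive U x).
  rewrite Derive_minus; [rewrite Derive_const; ring | apply Hd |].
  apply ex_derive_const.
- change (Derive (Derive_n (fun y => U y - a) (S j)) x
          = Derive (Derive_n U (S j)) x).
  now apply Derive_ext.
Qed.

Theorem lemma1 (taum : R) (htaum : 0 < taum)
    (f : R -> R) (hf : bistable f)
    (g : R -> R -> R) (hg : admissible_damping taum g)
    (tau : R) (htau : 0 <= tau <= taum)
    (c : R) (U : R -> R) (hU : monotone_front f g tau c U) :
  exists C eta : R, 0 < C /\ 0 < eta /\
    forall j : nat, (j <= 2)%nat ->
      (forall xi : R, 0 <= xi ->
         Rabs (Derive_n (fun x => U x - U_plus) j xi)
           <= C * exp (- eta * Rabs xi)) /\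
      (forall xi : R, xi <= 0 ->
         Rabs (Derive_n (fun x => U x - U_minus) j xi)
           <= C * exp (- eta * Rabs xi)).
Proof.
destruct (front_decay_right taum f g tau c U hf hg htau hU) as (R0 & R1 & R2).
destruct (front_decay_left taum f g tau c U hf hg htau hU) as (L0 & L1 & L2).
destruct (exp_decay_uniform _ _ R0 L0) as (C0 & e0 & HC0 & He0 & H0).
destruct (exp_decay_uniform _ _ R1 L1) as (C1 & e1 & HC1 & He1 & H1).
destruct (exp_decay_uniform _ _ R2 L2) as (C2 & e2 & HC2 & He2 & H2).
clear R0 R1 R2 L0 L1 L2.
set (C := C0 + C1 + C2). set (e := Rmin e0 (Rmin e1 e2)).
assert (He : 0 < e) by (repeat apply Rmin_glb_lt; easy).
assert (He0' : e <= e0) by apply Rmin_l.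
assert (He12 : e <= Rmin e1 e2) by apply Rmin_r.
generalize (Rmin_l e1 e2) (Rmin_r e1 e2); intros He1' He2'.
assert (HC : C0 <= C /\ C1 <= C /\ C2 <= C) by (unfold C; lra).
specialize (H0 C e ltac:(lra) ltac:(lra)).
specialize (H1 C e ltac:(lra) ltac:(lra)).
specialize (H2 C e ltac:(lra) ltac:(lra)).
exists C, e. split; [unfold C; lra |]. split; [easy |].
assert (Hd : forall y, ex_derive U y) by apply hU.
intros j Hj. split; intros x Hx.
- rewrite (Rabs_pos_eq x) by easy.
  destruct j as [| [| [| j]]]; [| | | lia].
  + simpl. unfold U_plus. rewrite Rabs_minus_sym. now apply H0.
  + rewrite Derive_n_minus_const by easy.
    rewrite <- Rabs_Ropp. now apply H1.
  + rewrite Derive_n_minus_const by easy.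
    rewrite <- Rabs_Ropp. now apply H2.
- rewrite (Rabs_left1 x) by easy.
  destruct j as [| [| [| j]]]; [| | | lia].
  + simpl. unfold U_minus. rewrite Rminus_0_r, <- (Ropp_involutive x) at 1.
    apply H0. lra.
  + rewrite Derive_n_minus_const by easy.
    rewrite <- Rabs_Ropp, <- (Ropp_involutive x) at 1. apply H1. lra.
  + rewrite Derive_n_minus_const by easy.
    rewrite <- (Ropp_involutive x) at 1. apply H2. lra.
Qed.
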